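(* Let $o\in X$ be a chosen root vertex, $f \in L(X^o)$ and $g \in L(\partial X)$. Then the boundary value problem $$\Delta^2 u = f \ \text{ on } X^o \quad\text{and}\quad \partial_{\vec n}u = g\ \text{ on }\partial X$$ is solvable (with $u\in L(X)$) if and only if $$\int_{X^o} G_{X^o} f\, d\pi + \int_{\partial X} g\, d\nu_{\pi} = 0 .$$ In this case, all solutions are given by $$G_{X \setminus \{o\}}G_{X^o}f + G_{X \setminus \{o\}} h + c, \quad \text{where} \quad h(x) = \int_{\partial X} g\, d\nu_x \ (x\in X) \quad\text{and}\quad c \in \mathbb{C}.$$
   Context: Let $(X,E)$ be a finite directed graph with $|X|\ge 2$, $E\subset X^2$ without loops, which is strongly connected. Each edge $(x,y)\in E$ carries a weight $a(x,y)>0$, and $a(x,y)=0$ if $(x,y)\notin E$. Put $m(x)=\sum_y a(x,y)$, $p(x,y)=a(x,y)/m(x)$, $P=(p(x,y))_{x,y\in X}$. $L(B)$ is the space of functions $B\to\mathbb{C}$ (column vectors), $Pu(x)=\sum_y p(x,y)u(y)$, and $\Delta=P-I$. $\pi$ denotes the unique stationary probability distribution of $P$ ($\pi P=\pi$, $\pi>0$, total mass $1$). Integrals are sums: $\int_A f\,d\mu=\sum_{x\in A}f(x)\mu(x)$. The boundary $\partial X$ is an arbitrary non-empty subset of $X$, and $X^o=X\setminus\partial X$. The outer normal derivative is $\partial_{\vec n}u(x)=-\Delta u(x)$ for $x\in\partial X$. For $A,B\subset X$, $P_{A,B}=(p(x,y))_{x\in A,y\in B}$ and $P_A=P_{A,A}$.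 For $A\subsetneq X$, $G_A=(I_A-P_A)^{-1}=\sum_{n\ge0}P_A^n$ (the inverse exists and the series converges); $G_A$ is also viewed as a matrix over $X\times X$ with entries $0$ outside $A\times A$. For $x\in X^o$ and $y\in\partial X$, $\nu_x(y)$ is the $(x,y)$-entry of $G_{X^o}P_{X^o,\partial X}$ (the probability that the Markov chain with transition matrix $P$ started at $x$ first enters $\partial X$ at $y$); for $x\in\partial X$, $\nu_x=\delta_x$. Finally $\nu_\pi=\sum_{x\in X}\pi(x)\,\nu_x$, a measure on $\partial X$. *)

(* Defs.v *)
From mathcomp Require Import all_boot all_order all_algebra.
From mathcomp Require Import reals.
From mathcomp Require Import complex.

Set Implicit Arguments.
Unset Strict Implicit.
Unset Printing Implicit Defensive.

Import Order.TTheory GRing.Theory Num.Theory.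
Local Open Scope ring_scope.
Local Open Scope complex_scope.

(* Functions on a subset B of X are represented by total functions on X of    *)
(* which only the values on B are ever used.                                  *)

Definition strongly_connected (X : finType) (E : rel X) : Prop :=
  forall x y : X, connect E x y.

Definition edge_weight (R : realType) (X : finType) (E : rel X)
    (a : X -> X -> R) : Prop :=
  (forall x y, E x y -> 0 < a x y) /\ (forall x y, ~~ E x y -> a x y = 0).

Section Network.
Variables (R : realType) (X : finType).

(* The action u |-> K u of a real X x X matrix on complex functions. *)
Definition act (K : X -> X -> R) (u : X -> R[i]) (x : X) : R[i] :=
  \sum_y (K x y)%:C * u y.

Definition integral (A : {set X}) (f : X -> R[i]) (mu : X -> R) : R[i] :=
  \sum_(x in A) f x * (mu x)%:C.

Variable a : X -> X -> R.

Definition mass (x : X) : R := \sum_y a x y.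

Definition trans (x y : X) : R := a x y / mass x.

Definition laplacian (u : X -> R[i]) (x : X) : R[i] := act trans u x - u x.

(* Meaningful at boundary points x only. *)
Definition normal_derivative (u : X -> R[i]) (x : X) : R[i] := - laplacian u x.

Definition stationary_distribution (pi : X -> R) : Prop :=
  [/\ forall x, 0 < pi x, \sum_x pi x = 1 &
      forall y, \sum_x pi x * trans x y = pi y].

(* The matrix P_A, its rows and columns being numbered by enum_val. *)
Definition trans_restr (A : {set X}) : 'M[R]_#|A| :=
  \matrix_(i, j) trans (enum_val i) (enum_val j).

(* G_A = (I_A - P_A)^-1 extended by 0 outside A x A: the double sum is empty  *)
(* unless x and y are in A, and has exactly one term when they are.           *)
Definition green (A : {set X}) (x y : X) : R :=
  \sum_(i < #|A| | enum_val i == x) \sum_(j < #|A| | enum_val j == y)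
    invmx (1%:M - trans_restr A) i j.

(* The hitting distribution nu_x of the boundary D, as a function of y \in D. *)
Definition hitting (D : {set X}) (x y : X) : R :=
  if x \in D then (x == y)%:R
  else \sum_(z in ~: D) green (~: D) x z * trans z y.

Definition hitting_from (pi : X -> R) (D : {set X}) (y : X) : R :=
  \sum_x pi x * hitting D x y.

Definition solves_bvp (D : {set X}) (f g u : X -> R[i]) : Prop :=
  (forall x, x \in ~: D -> laplacian (laplacian u) x = f x) /\
  (forall x, x \in D -> normal_derivative u x = g x).

End Network.

(* Main.v *)
Require Import Defs.
From mathcomp Require Import all_boot all_order all_algebra.
From mathcomp Require Import reals.
From mathcomp Require Import complex.

Set Implicit Arguments.
Unset Strict Implicit.
Unset Printing Implicit Defensive.

Import Order.TTheory GRing.Theory Num.Theory.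
Local Open Scope ring_scope.
Local Open Scope complex_scope.

(** Put F = G f + h, with G the Green operator of the interior of the boundary D
    and h the function obtained by integrating g against the hitting
    distributions; G f vanishes on D, while h equals g on D and is harmonic in
    the interior. The boundary value problem says that the function Lap u equals
    -g on D and has Laplacian f in the interior. The function -F has these two
    properties as well, and such a function is unique, so the fourth-order
    problem is equivalent to the Poisson equation Lap u = -F on all of X
    ([bvp_poisson]).

    For the Poisson equation, the stationary measure pi annihilates the range of
    Lap, so the total pi-mass of F has to vanish; this mass is the compatibility
    integral of the theorem ([compatibility_integral]). Conversely, applying the
    Green operator of X without o to F solves the equation off o, and the
    equation at o then follows since both sides are annihilated by pi and
    pi o > 0 ([poisson_green]). Two solutions differ by a constant
    ([poisson_solutions]).

    Both uniqueness statements, and also the invertibility of I - P_A that makes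
    the matrix defining the Green function a genuine inverse, come from one fact:
    by strong connectedness, a function that is subharmonic on A attains its
    maximum outside A ([maximum_principle]). It is applied with A the interior
    and with A the complement of o. *)

(** * Sums over the numbering of a subset *)

Section ExtensionByZero.
Variables (V : nmodType) (X : finType) (A : {set X}).

Lemma sum_enum_val_in (F : 'I_#|A| -> V) (k : 'I_#|A|) :
  \sum_(i < #|A| | enum_val i == enum_val k) F i = F k.
Proof. by rewrite (big_pred1 k) // => i; rewrite /= (inj_eq enum_val_inj). Qed.

Lemma sum_enum_val_out (F : 'I_#|A| -> V) x :
  x \notin A -> \sum_(i < #|A| | enum_val i == x) F i = 0.
Proof.
move=> xA; rewrite big_pred0 // => i; apply/negP => /eqP ix.
by move: (enum_valP i); rewrite ix (negPf xA).
Qed.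

Lemma sum_supported (G : X -> V) :
  (forall x, x \notin A -> G x = 0) ->
  \sum_x G x = \sum_(i < #|A|) G (enum_val i).
Proof.
move=> G0; rewrite -[RHS](big_enum_val (fun i => G i)) [LHS](bigID (mem A)) /=.
by rewrite [X in _ + X]big1 ?addr0.
Qed.

End ExtensionByZero.

(** * Real matrices acting on complex functions *)

Section ComplexParts.
Variables (R : realType) (X : finType).

Lemma complex_Re_sum (F : X -> R[i]) :
  complex.Re (\sum_x F x) = \sum_x complex.Re (F x).
Proof. by apply: (big_morph (@complex.Re R)) => // [[? ?] [? ?]]. Qed.

Lemma complex_Im_sum (F : X -> R[i]) :
  complex.Im (\sum_x F x) = \sum_x complex.Im (F x).
Proof. by apply: (big_morph (@complex.Im R)) => // [[? ?] [? ?]]. Qed.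

(** This law and the next two keep [%:C] as the head symbol; rewriting with the
    generic morphism laws leaves the projection of the morphism structure in the
    goal, where later rewrites do not recognize it. *)
Lemma real_complexM (r s : R) : (r * s)%:C = r%:C * s%:C.
Proof. exact: rmorphM. Qed.

Lemma real_complexB (r s : R) : (r - s)%:C = r%:C - s%:C.
Proof. exact: rmorphB. Qed.

Lemma real_complex_sum (P : pred X) (r : X -> R) :
  (\sum_(x | P x) r x)%:C = \sum_(x | P x) (r x)%:C.
Proof. exact: rmorph_sum. Qed.

Lemma Re_act (K : X -> X -> R) u x :
  complex.Re (act K u x) = \sum_y K x y * complex.Re (u y).
Proof.
rewrite /act complex_Re_sum; apply: eq_bigr => y _.
by case: (u y) => ? ? /=; rewrite mul0r subr0.
Qed.

Lemma Im_act (K : X -> X -> R) u x :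
  complex.Im (act K u x) = \sum_y K x y * complex.Im (u y).
Proof.
rewrite /act complex_Im_sum; apply: eq_bigr => y _.
by case: (u y) => ? ? /=; rewrite mul0r addr0.
Qed.

Lemma actD (K : X -> X -> R) u v x :
  act K (fun y => u y + v y) x = act K u x + act K v x.
Proof. by rewrite /act -big_split; apply: eq_bigr => y _; rewrite mulrDr. Qed.

Lemma act_sum_delta (F : X -> R[i]) x :
  \sum_y ((x == y)%:R : R)%:C * F y = F x.
Proof.
rewrite (bigD1 x) //= eqxx mul1r big1 ?addr0 // => y.
by rewrite eq_sym => /negPf ->; rewrite mul0r.
Qed.

End ComplexParts.

(** * Transition probabilities and the maximum principle *)

Section PotentialTheory.
Variables (R : realType) (X : finType) (E : rel X) (a : X -> X -> R).
Hypotheses (hX : (2 <= #|X|)%N) (hconn : strongly_connected E).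
Hypothesis ha : edge_weight E a.

Local Notation p := (trans a).
Local Notation L := (laplacian a).

Lemma edge_weight_ge0 x y : 0 <= a x y.
Proof.
by case: ha => hE hN; case: (boolP (E x y)) => [/hE/ltW|/hN ->].
Qed.

(** A strongly connected graph with two vertices has an edge out of every
    vertex; hence the transition matrix is stochastic. *)
Lemma mass_gt0 x : 0 < mass a x.
Proof.
have [y xy] : exists y, y != x.
  have : (0 < #|predC1 x|)%N by rewrite cardC1 -ltnS prednK // (ltn_trans _ hX).
  by case/card_gt0P => y; exists y.
case/connectP: (hconn x y) => [[|z q] /= hq yE]; first by rewrite yE eqxx in xy.
case/andP: hq => /(proj1 ha) axz _; rewrite /mass (bigD1 z) //=.
by rewrite ltr_wpDr // sumr_ge0 // => w _; apply: edge_weight_ge0.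
Qed.

Lemma trans_ge0 x y : 0 <= p x y.
Proof. by rewrite divr_ge0 ?edge_weight_ge0 // ltW // mass_gt0. Qed.

Lemma trans_gt0 x y : E x y -> 0 < p x y.
Proof. by move=> xy; rewrite divr_gt0 ?mass_gt0 // (proj1 ha). Qed.

Lemma trans_sum1 x : \sum_y p x y = 1.
Proof. by rewrite -mulr_suml divff // gt_eqF // mass_gt0. Qed.

(** At a maximum point in A the value is at most an average of values that do not
    exceed it, so the maximum is also attained at every successor. Following a
    path from a maximum point to b, the property of being a maximum point
    propagates until the path leaves A. *)
Lemma maximum_principle (A : {set X}) (b : X) (v : X -> R) :
  b \notin A -> (forall x, x \in A -> v x <= \sum_y p x y * v y) ->
  exists2 z, z \notin A & forall y, v y <= v z.
Proof.
move=> bA sub.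
have [x0 x0max] : exists x0, forall y, v y <= v x0.
  by case: (@Order.TotalTheory.arg_maxP _ _ _ b xpredT v) => // x0 _ h;
    exists x0 => y; apply: h.
case/connectP: (hconn x0 b) => q hq bE; rewrite {b}bE in bA.
elim: q x0 x0max hq bA => [|y q IH] x xmax /=; first by exists x.
case/andP=> xy hq hb; case: (boolP (x \in A)) => xA; last by exists x.
apply: (IH y) => //.
have terms z : 0 <= p x z * (v x - v z).
  by rewrite mulr_ge0 ?trans_ge0 // subr_ge0.
have zero : \sum_z p x z * (v x - v z) = 0.
  apply/eqP; rewrite eq_le sumr_ge0 // andbT.
  under eq_bigr do rewrite mulrBr.
  by rewrite sumrB -mulr_suml trans_sum1 mul1r subr_le0 sub.
have := psumr_eq0P (fun z _ => terms z) zero (i := y) isT.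
move/eqP; rewrite mulf_eq0 gt_eqF ?trans_gt0 //= subr_eq0 => /eqP <-.
exact: xmax.
Qed.

(** The maximum principle for v and for -v. With A the complement of a single
    point and c the value there, it says that a function harmonic off that point
    is constant. *)
Lemma real_dirichlet_uniqueness (A : {set X}) (b : X) (v : X -> R) c :
  b \notin A -> (forall x, x \in A -> v x = \sum_y p x y * v y) ->
  (forall x, x \notin A -> v x = c) -> forall x, v x = c.
Proof.
move=> bA harm vc x; apply/eqP; rewrite eq_le; apply/andP; split.
  case: (@maximum_principle A b v) => // [y yA | z zA /(_ x)]; last first.
    by rewrite (vc z).
  by rewrite -harm.
case: (@maximum_principle A b (fun y => - v y)) => // [y yA | z zA /(_ x)].
  by under eq_bigr do rewrite mulrN; rewrite sumrN -harm.
by rewrite (vc z) // lerN2.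
Qed.

Lemma dirichlet_uniqueness (A : {set X}) (b : X) (u : X -> R[i]) c :
  b \notin A -> (forall x, x \in A -> L u x = 0) ->
  (forall x, x \notin A -> u x = c) -> forall x, u x = c.
Proof.
move=> bA harm uc x.
have actE y : y \in A -> act p u y = u y.
  by move=> yA; apply/eqP; rewrite -subr_eq0; apply/eqP/harm.
apply/eqP; rewrite eq_complex; apply/andP; split; apply/eqP.
  apply: (@real_dirichlet_uniqueness A b (fun x => complex.Re (u x))) => //.
    by move=> y /actE uE; rewrite -Re_act uE.
  by move=> y /uc ->.
apply: (@real_dirichlet_uniqueness A b (fun x => complex.Im (u x))) => //.
  by move=> y /actE uE; rewrite -Im_act uE.
by move=> y /uc ->.
Qed.

Lemma eq_laplacian u v : (forall x, u x = v x) -> forall x, L u x = L v x.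
Proof.
move=> uv x; rewrite /laplacian uv; congr (_ - _).
by apply: eq_bigr => y _; rewrite uv.
Qed.

Lemma laplacianD u v x : L (fun y => u y + v y) x = L u x + L v x.
Proof. by rewrite /laplacian actD opprD addrACA. Qed.

Lemma laplacianN u x : L (fun y => - u y) x = - L u x.
Proof.
rewrite /laplacian /act; under eq_bigr do rewrite mulrN.
by rewrite sumrN opprB opprK addrC.
Qed.

Lemma laplacianDc u c x : L (fun y => u y + c) x = L u x.
Proof.
have Pc : act p (fun=> c) x = c.
  by rewrite /act -mulr_suml -real_complex_sum trans_sum1 mul1r.
by rewrite laplacianD [X in _ + X]/laplacian Pc subrr addr0.
Qed.

(** * The Green function as a right inverse *)

(** A vector in the kernel of I - P_A, extended by zero, is harmonic on A and
    vanishes off A, so it is zero by the maximum principle. *)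
Lemma dirichlet_operator_unit (A : {set X}) (b : X) :
  b \notin A -> 1%:M - trans_restr a A \in unitmx.
Proof.
move=> bA; rewrite -unitmx_tr unitmxE unitfE; apply/negP => /det0P [v /eqP v0 vM].
apply: v0; pose w x := \sum_(i < #|A| | enum_val i == x) v 0 i.
have w0 x : w x = 0.
  apply: (@real_dirichlet_uniqueness A b w) => // [{}x xA|y yA]; last first.
    exact: sum_enum_val_out.
  rewrite (@sum_supported _ _ A); last first.
    by move=> y yA; rewrite /w sum_enum_val_out // mulr0.
  rewrite -(enum_rankK_in xA xA) /w sum_enum_val_in.
  set k := enum_rank_in xA x.
  move/matrixP/(_ 0 k): vM; rewrite !mxE => /eqP.
  under eq_bigr do rewrite !mxE mulrBr.
  rewrite sumrB (bigD1 k) //= eqxx mulr1 big1 ?addr0; last first.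
    by move=> i; rewrite eq_sym => /negPf ->; rewrite mulr0.
  rewrite subr_eq0 => /eqP ->; apply: eq_bigr => j _.
  by rewrite sum_enum_val_in mulrC.
by apply/rowP => k; rewrite mxE -(w0 (enum_val k)) /w sum_enum_val_in.
Qed.

Lemma green_out (A : {set X}) x y : x \notin A -> green a A x y = 0.
Proof. exact: sum_enum_val_out. Qed.


(** The identity (I - P_A) G_A = I_A, read in X x X: rows of the full matrix P
    may replace those of P_A because the columns of G_A vanish off A. *)
Lemma green_resolvent (A : {set X}) (b : X) x y : b \notin A -> x \in A ->
  \sum_z p x z * green a A z y = green a A x y - ((x == y)%:R : R).
Proof.
move=> bA xA; have U := dirichlet_operator_unit bA.
case: (boolP (y \in A)) => yA; last first.
  have g0 z : green a A z y = 0.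
    by rewrite /green big1 // => i _; rewrite sum_enum_val_out.
  rewrite g0 big1 => [|z _]; last by rewrite g0 mulr0.
  by case: eqP xA yA => [-> -> // | _ _ _]; rewrite subr0.
rewrite (@sum_supported _ _ A); last first.
  by move=> z zA; rewrite /green sum_enum_val_out // mulr0.
rewrite -(enum_rankK_in xA xA) -(enum_rankK_in yA yA).
move: (enum_rank_in xA x) (enum_rank_in yA y) => k l {x y xA yA}.
have ge i : green a A (enum_val i) (enum_val l) =
    invmx (1%:M - trans_restr a A) i l.
  by rewrite /green sum_enum_val_in sum_enum_val_in.
under eq_bigr do rewrite ge; rewrite ge (inj_eq enum_val_inj).
have /matrixP/(_ k l) := mulmxV U; rewrite mulmxBl mul1mx !mxE.
under [X in _ - X = _]eq_bigr do rewrite mxE.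
by move=> <-; rewrite subKr.
Qed.

Lemma act_green_out (A : {set X}) F x : x \notin A -> act (green a A) F x = 0.
Proof.
move=> xA; rewrite /act big1 // => y _.
by rewrite /green sum_enum_val_out // mul0r.
Qed.

Lemma laplacian_green (A : {set X}) (b : X) F x : b \notin A -> x \in A ->
  L (act (green a A) F) x = - F x.
Proof.
move=> bA xA; rewrite /laplacian {1}/act.
have -> : \sum_y (p x y)%:C * act (green a A) F y =
    \sum_y (\sum_z p x z * green a A z y)%:C * F y.
  under eq_bigr do rewrite /act mulr_sumr.
  rewrite exchange_big /=; apply: eq_bigr => y _.
  rewrite real_complex_sum mulr_suml; apply: eq_bigr => z _.
  by rewrite (real_complexM (p x z)) mulrA.
under eq_bigr do rewrite (green_resolvent _ bA xA) real_complexB mulrBl.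
by rewrite sumrB act_sum_delta -/(act _ _ _) addrAC subrr add0r.
Qed.

(** * The harmonic extension of boundary data *)

Section HittingExtension.
Variables (D : {set X}) (g : X -> R[i]).
Local Notation h := (fun x => integral D g (hitting a D x)).

Lemma hitting_extension_boundary x : x \in D -> h x = g x.
Proof.
move=> xD; rewrite /integral -[RHS]act_sum_delta [RHS](bigID (mem D)) /=.
rewrite [X in _ = _ + X]big1 ?addr0; last first.
  by move=> y yD; case: eqP => [xy | _]; [rewrite -xy xD in yD | rewrite mul0r].
by apply: eq_bigr => y _; rewrite /hitting xD mulrC.
Qed.

(** In the interior, h is the Green potential of the function that sends z to the
    g-average of one step from z into D; its harmonicity follows, since taking
    the Laplacian of the potential produces exactly minus this average, which is
    the contribution of D to P h. *)
Lemma hitting_extension_interior x : x \in ~: D ->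
  h x = act (green a (~: D)) (fun z => \sum_(y in D) (p z y)%:C * g y) x.
Proof.
rewrite inE => /negPf xD; rewrite /integral /act.
rewrite [RHS](bigID (mem (~: D))) /= [X in _ = _ + X]big1 ?addr0; last first.
  move=> z zD; rewrite /green big1 ?mul0r // => i _.
  exact: sum_enum_val_out.
under [RHS]eq_bigr do rewrite mulr_sumr.
rewrite exchange_big /=; apply: eq_bigr => y yD.
rewrite /hitting xD real_complex_sum mulr_sumr; apply: eq_bigr => z _.
by rewrite (real_complexM _ (p z y)) mulrC mulrA.
Qed.

Lemma hitting_extension_harmonic x :
  D != set0 -> x \in ~: D -> L h x = 0.
Proof.
case/set0Pn => b bD xD.
have bA : b \notin ~: D by rewrite inE bD.
pose k z := \sum_(y in D) (p z y)%:C * g y.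
have := laplacian_green k bA xD; rewrite /laplacian -hitting_extension_interior //.
move/eqP; rewrite subr_eq => /eqP E1.
rewrite /act (bigID (mem D)) /=.
under eq_bigr => y yD do rewrite hitting_extension_boundary //.
have -> : \sum_(y | y \notin D) (p x y)%:C * h y = act p (act (green a (~: D)) k) x.
  rewrite [RHS]/act [RHS](bigID (mem D)) /= [X in _ = X + _]big1 ?add0r.
    by apply: eq_bigr => y yD; rewrite hitting_extension_interior // inE.
  by move=> y yD; rewrite act_green_out ?mulr0 // inE yD.
by rewrite E1 addrA subrr add0r subrr.
Qed.

End HittingExtension.

(** * Reduction to the Poisson equation *)

(** Both Lap u and -(G f + h) solve the Dirichlet problem with Laplacian f in the
    interior and boundary values -g; the sign comes from the normal derivative
    being -Lap u. *)
Lemma bvp_poisson (D : {set X}) f g u : D != set0 ->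
  solves_bvp a D f g u <->
  forall x, L u x =
    - (act (green a (~: D)) f x + integral D g (hitting a D x)).
Proof.
move=> hD; have [b bD] := set0Pn _ hD.
have bA : b \notin ~: D by rewrite inE bD.
have LF x : x \in ~: D ->
    L (fun y => act (green a (~: D)) f y + integral D g (hitting a D y)) x
      = - f x.
  move=> xD; rewrite laplacianD (laplacian_green _ bA xD).
  by rewrite hitting_extension_harmonic // addr0.
split=> [[hf hg] x | Lu].
  apply/eqP; rewrite -addr_eq0; apply/eqP.
  apply: (@dirichlet_uniqueness (~: D) b
    (fun x => L u x + (_ + _)) 0 bA) => {}x xD.
    by rewrite laplacianD LF // hf // subrr.
  move: (xD); rewrite inE negbK => xD'.
  by rewrite act_green_out // add0r hitting_extension_boundary // -hg // subrr.
split=> x xD; last first.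
  rewrite /normal_derivative Lu opprK hitting_extension_boundary //.
  by rewrite act_green_out ?add0r // inE xD.
by rewrite (eq_laplacian Lu) laplacianN LF // opprK.
Qed.

(** * The Poisson equation on the whole network *)

Section Poisson.
Variables (pi : X -> R).
Hypothesis hpi : stationary_distribution a pi.

Lemma stationary_laplacian u : \sum_x L u x * (pi x)%:C = 0.
Proof.
case: hpi => _ _ st; rewrite /laplacian.
under eq_bigr do rewrite mulrBl /act mulr_suml.
rewrite sumrB exchange_big /= -sumrB big1 // => y _.
rewrite -(st y) real_complex_sum mulr_sumr -sumrB big1 // => x _.
by rewrite (real_complexM (pi x)) [u y * _]mulrC [_ * (pi x)%:C]mulrC mulrA subrr.
Qed.

(** Off o this is the Green identity. The pi-masses of both sides vanish, so the
    only remaining term, pi o times the defect at o, vanishes too. *)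
Lemma poisson_green o F :
  \sum_x F x * (pi x)%:C = 0 ->
  forall x, L (act (green a [set~ o]) F) x = - F x.
Proof.
move=> F0 x; have oA : o \notin [set~ o] by rewrite !inE eqxx.
case: (eqVneq x o) => [-> | xo]; last by rewrite (laplacian_green _ oA) // !inE.
pose u := act (green a [set~ o]) F.
have : \sum_x (L u x + F x) * (pi x)%:C = 0.
  under eq_bigr do rewrite mulrDl.
  by rewrite big_split /= stationary_laplacian F0 addr0.
rewrite (bigD1 o) //= [X in _ + X]big1 ?addr0; last first.
  by move=> y yo; rewrite (laplacian_green _ oA) ?inE // addNr mul0r.
move/eqP; rewrite mulf_eq0 addr_eq0 => /orP[/eqP // |].
rewrite -[0]/(0%:C) (inj_eq (@complexI R)) gt_eqF //; by case: hpi.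
Qed.

Lemma poisson_solvable (o : X) F :
  (exists u, forall x, L u x = - F x) <-> \sum_x F x * (pi x)%:C = 0.
Proof.
split=> [[u Lu] | F0]; last by eexists; exact: (poisson_green o F0).
apply/eqP; rewrite -oppr_eq0 -sumrN; apply/eqP.
by rewrite -[RHS](stationary_laplacian u); apply: eq_bigr => x _; rewrite Lu mulNr.
Qed.

(** The difference of two solutions is harmonic, hence constant; the Green
    potential vanishes at o, so the constant is the value of u at o. *)
Lemma poisson_solutions o F u : \sum_x F x * (pi x)%:C = 0 ->
  (forall x, L u x = - F x) <->
  exists c, forall x, u x = act (green a [set~ o]) F x + c.
Proof.
move=> F0; have LG := poisson_green o F0.
split=> [Lu | [c uE] x]; last by rewrite (eq_laplacian uE) laplacianDc.
have oA : o \notin [set~ o] by rewrite !inE eqxx.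
exists (u o) => x; apply/eqP; rewrite addrC -subr_eq; apply/eqP.
apply: (@dirichlet_uniqueness [set~ o] o
    (fun x => u x - act (green a [set~ o]) F x) (u o) oA) => {}x xA.
  by rewrite laplacianD laplacianN Lu LG subrr.
by rewrite act_green_out // subr0; move: xA; rewrite !inE negbK => /eqP ->.
Qed.

End Poisson.

(** The pi-average of the hitting distributions is the hitting distribution from
    pi, and the Green potential of f vanishes on D. *)
Lemma compatibility_integral (pi : X -> R) (D : {set X}) f g :
  \sum_x (act (green a (~: D)) f x + integral D g (hitting a D x)) * (pi x)%:C =
  integral (~: D) (act (green a (~: D)) f) pi
    + integral D g (hitting_from a pi D).
Proof.
under eq_bigr do rewrite mulrDl.
rewrite big_split /=; congr (_ + _).
  rewrite (bigID (mem (~: D))) /= [X in _ + X]big1 ?addr0 //.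
  by move=> x xD; rewrite act_green_out // mul0r.
under eq_bigr do rewrite /integral mulr_suml.
rewrite exchange_big /=; apply: eq_bigr => y _.
rewrite /hitting_from real_complex_sum mulr_sumr; apply: eq_bigr => x _.
by rewrite (real_complexM (pi x)) -mulrA [(pi x)%:C * _]mulrC.
Qed.

End PotentialTheory.

Theorem mainTheorem6 (R : realType) (X : finType) (hX : (2 <= #|X|)%N)
  (E : rel X) (hloop : irreflexive E) (hconn : strongly_connected E)
  (a : X -> X -> R) (ha : edge_weight E a)
  (pi : X -> R) (hpi : stationary_distribution a pi)
  (D : {set X}) (hD : D != set0)
  (o : X) (f g : X -> R[i]) :
  let Gint := act (green a (~: D)) in
  let Go := act (green a [set~ o]) in
  let h := fun x => integral D g (hitting a D x) in
  let compat := integral (~: D) (Gint f) pi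
                + integral D g (hitting_from a pi D) = 0 in
  ((exists u : X -> R[i], solves_bvp a D f g u) <-> compat) /\
  (compat -> forall u : X -> R[i],
    solves_bvp a D f g u <->
    exists c : R[i], forall x, u x = Go (Gint f) x + Go h x + c).
Proof.
move=> Gint Go h compat; rewrite /compat /Gint -compatibility_integral.
have bvp := bvp_poisson hX hconn ha f g _ hD.
split=> [|F0 u].
  rewrite -(poisson_solvable hX hconn ha hpi o).
  by split=> -[u hu]; exists u; apply/bvp.
rewrite bvp (poisson_solutions hX hconn ha hpi o _ F0).
by split=> -[c uE]; exists c => x; rewrite uE actD.
Qed.
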